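(* Let $\mathscr I$ be an ideal on $\omega$. Then the following are equivalent: (1) $\mathcal J_L^f\le_{\mathrm K}\mathscr I$ for all $f\in\omega^\omega$ such that $\lim_{n\to\infty}f(n)=\infty$. (2) $\mathcal J_L^f\le_{\mathrm K}\mathscr I$ for some $f\in\omega^\omega$ such that $\lim_{n\to\infty}f(n)=\infty$. (3) $\mathscr I$ is not locally linear selective.
   Context: Ideals on a countable set are assumed proper and to contain all finite sets. For $f\in\omega^\omega$ with $\lim_nf(n)=\infty$, $\mathcal J_L^f=\{A\subseteq\omega\times\omega:\exists k<\omega\,\forall^\infty i<\omega\ |\{m:\langle i,m\rangle\in A\}|\le k\cdot f(i)\}$, an ideal on $\omega\times\omega$. For ideals $\mathscr J$ on $X$ and $\mathscr I$ on $Y$, $\mathscr J\le_{\mathrm K}\mathscr I$ (Katětov reducibility) means there is $\pi\colon Y\to X$ with $\pi^{-1}[A]\in\mathscr I$ for all $A\in\mathscr J$. Given a partition $\bar P=(P_i)_{i<\omega}$ of $\omega$ (pieces are allowed to be empty), $A\subseteq\omega$ is a linear selector of $\bar P$ if $|A\cap P_i|\le i$ for all $i<\omega$. An ideal $\mathscr I$ on $\omega$ is locally linear selective if for every partition $\bar P=(P_i)_{i<\omega}$ of $\omega$ into sets in $\mathscr I$ there is a linear selector $A$ of $\bar P$ with $A\notin\mathscr I$. *)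

(* Defs.v *)
From mathcomp Require Import all_boot.
From mathcomp Require Import boolp classical_sets functions cardinality filter.

Set Implicit Arguments.
Unset Strict Implicit.
Unset Printing Implicit Defensive.

Local Open Scope classical_set_scope.
Local Open Scope card_scope.

(* Proper ideals containing every finite set. *)
Record is_ideal (X : Type) (I : set (set X)) : Prop := IsIdeal {
  ideal_proper : ~ I [set: X];
  ideal_finite : forall A : set X, finite_set A -> I A;
  ideal_subset : forall A B : set X, A `<=` B -> I B -> I A;
  ideal_setU : forall A B : set X, I A -> I B -> I (A `|` B)
}.

Definition JL (f : nat -> nat) : set (set (nat * nat)) :=
  [set A | exists k : nat,
    \forall i \near \oo, [set m | A (i, m)] #<= `I_(k * f i)].

Definition katetov_le (X Y : Type) (J : set (set X)) (I : set (set Y)) : Prop :=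
  exists pi : Y -> X, forall A : set X, J A -> I (pi @^-1` A).

(* Unlike the library's [partition], pieces may be empty. *)
Definition is_partition (P : nat -> set nat) : Prop :=
  trivIset [set: nat] P /\ \bigcup_i P i = [set: nat].

Definition linear_selector (P : nat -> set nat) (A : set nat) : Prop :=
  forall i : nat, A `&` P i #<= `I_i.

Definition locally_linear_selective (I : set (set nat)) : Prop :=
  forall P : nat -> set nat, is_partition P -> (forall i, I (P i)) ->
    exists2 A : set nat, linear_selector P A & ~ I A.

Lemma card_le_setU_II (T : Type) (A B : set T) (a b : nat) :
  A #<= `I_a -> B #<= `I_b -> A `|` B #<= `I_(a + b).
Proof.
move=> /pcard_leP[f] /pcard_leP[g].
pose h x := if x \in A then f x else a + g x.
have fa x : A x -> f x < a by move=> Ax; exact: (@funS _ _ _ _ f _ Ax).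
have gb x : B x -> g x < b by move=> Bx; exact: (@funS _ _ _ _ g _ Bx).
have hI : set_inj (A `|` B) h.
  move=> x y; rewrite !inE /h => xAB yAB.
  case: ifPn; case: ifPn; rewrite ?inE ?notin_setE => yA xA.
  - by move=> /(@inj _ _ _ f); rewrite !inE; apply.
  - by move=> e; have := fa _ xA; rewrite e ltnNge leq_addr.
  - by move=> e; have := fa _ yA; rewrite -e ltnNge leq_addr.
  - case: xAB => // xB; case: yAB => // yB.
    by move=> /addnI /(@inj _ _ _ g); rewrite !inE; apply.
have <- : (h @` (A `|` B) #<= `I_(a + b)) = (A `|` B #<= `I_(a + b)).
  by apply: card_le_eql; exact: inj_card_eq.
apply: subset_card_le => _ [x xAB <-]; rewrite /h /=.
case: ifPn; rewrite ?inE ?notin_setE => xA.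
  exact: ltn_addr (fa _ xA).
by case: xAB => // xB; rewrite ltn_add2l gb.
Qed.

Lemma JL_ideal (f : nat -> nat) : is_ideal (JL f).
Proof.
split.
- case=> k [N _ /(_ N (leqnn N))] /= H.
  apply: infinite_nat; apply/finite_set_leP; exists (k * f N).
  by apply: card_le_trans H; exact: subset_card_le.
- move=> A finA; exists 0.
  have [M HM] : exists M, forall x, A x -> x.1 < M.
    have /finite_seqP[s sE] := finite_image fst finA.
    exists (\max_(i <- s) i).+1 => x Ax; rewrite ltnS.
    have xs : x.1 \in s.
      have : (fst @` A) x.1 by exists x.
      by rewrite sE.
    exact: leq_bigmax_seq.
  exists M => // i /= Mi; rewrite mul0n.
  rewrite [X in X #<= _](_ : _ = set0) ?card_ge0//.
  by rewrite -subset0 => m /= /HM /=; rewrite ltnNge Mi.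
- move=> A B AB [k [N _ H]]; exists k, N => // i /H /=; apply: card_le_trans.
  by apply: subset_card_le => m; exact: AB.
- move=> A B [k [N _ H]] [l [M _ K]]; exists (k + l), (maxn N M) => // i /=.
  rewrite geq_max => /andP[/H /= Hi /K /= Ki]; rewrite mulnDl.
  exact: card_le_setU_II Hi Ki.
Qed.

(* Main.v *)
(** For (2) => (3), let [pi] witness [JL f <=_K I]. Grouping [omega] according
    to the value of [f] on the first coordinate of [pi] gives a partition into
    sets of [I], and the [pi]-image of a linear selector of it has at most
    [f i] points in column [i], so every linear selector is in [I].
    For (3) => (1), let [P] be a partition into sets of [I] all of whose linear
    selectors are in [I], and choose [g] tending to infinity so slowly that
    [g j * f (g j) <= j]. Sending [n] in [P j] to [(g j, n)] is a Katetov
    reduction: the preimage of a set with columns of size at most [k * f i]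
    meets [P j] in at most [k * f (g j) <= j] points as soon as [g j] is
    large. *)
Require Import Defs.
From mathcomp Require Import all_boot.
From mathcomp Require Import boolp classical_sets functions cardinality filter.

Set Implicit Arguments.
Unset Strict Implicit.
Unset Printing Implicit Defensive.

Local Open Scope classical_set_scope.
Local Open Scope card_scope.

Lemma ideal_bigcup_II (X : Type) (I : set (set X)) (hI : is_ideal I)
    (F : nat -> set X) (n : nat) :
  (forall i, I (F i)) -> I (\bigcup_(i in `I_n) F i).
Proof.
move=> IF; elim: n => [|n IHn].
  by rewrite II0 bigcup_set0; exact: ideal_finite.
by rewrite IIS bigcup_setU bigcup_set1; exact: ideal_setU.
Qed.

Lemma partition_index (P : nat -> set nat) : is_partition P ->
  exists c : nat -> nat, forall n i, P i n <-> c n = i.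
Proof.
move=> [triv cov].
have /choice[c cP] : forall n, exists i, P i n.
  move=> n; have : [set: nat] n by [].
  by rewrite -cov => -[i _ Pin]; exists i.
exists c => n i; split=> [Pin|<-//].
by apply: triv => //; exists n.
Qed.

(** Take for [g j] the largest [i <= j] with [i * f i <= j]: requiring [i <= j] guarantees a maximum
    even where [f] vanishes, and each fixed [i] is a candidate for all large [j]. *)
Lemma slow_reindexing (f : nat -> nat) : exists g : nat -> nat,
  (forall j, g j * f (g j) <= j) /\
  (forall i, \forall j \near \oo, i <= g j).
Proof.
pose Q j i := (i <= j) && (i * f i <= j).
have /choice[g gP] : forall j, exists i, Q j i /\ forall i', Q j i' -> i' <= i.
  move=> j; have exQ : exists i, Q j i by exists 0; rewrite /Q mul0n.
  have ubQ i : Q j i -> i <= j by case/andP.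
  by case: (ex_maxnP exQ ubQ) => i Qi maxi; exists i.
exists g; split=> [j|i]; first by have [/andP[]] := gP j.
exists (maxn i (i * f i)) => // j /=; rewrite geq_max => Qji.
by have [_] := gP j; apply.
Qed.

Lemma katetov_le_JL_not_selective (I : set (set nat)) (hI : is_ideal I)
    (f : nat -> nat) :
  f @ \oo --> \oo -> katetov_le (JL f) I -> ~ locally_linear_selective I.
Proof.
move=> foo [pi piP] sel.
pose P j := [set n | f (pi n).1 = j].
have partP : is_partition P.
  split; first by move=> i j _ _ [n [<- <-]].
  by apply/seteqP; split=> // n _; exists (f (pi n).1).
have IP j : I (P j).
  (* Column [i] of this set is empty once [f i > j], so [k = 0] works. *)
  apply: (piP [set p | f p.1 = j]); exists 0.
  have : \forall i \near \oo, j < f i by apply: (foo [set n | j < n]); exists j.+1.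
  apply: filterS => i ltjf; rewrite mul0n.
  rewrite [X in X #<= _](_ : _ = set0) ?card_ge0//.
  by rewrite -subset0 => m /= fij; rewrite fij ltnn in ltjf.
have [A selA nIA] := sel P partP IP.
apply: nIA; apply: (ideal_subset hI (B := pi @^-1` (pi @` A))).
  by move=> n An; exists n.
apply: piP; exists 1; apply: filterE => i; rewrite mul1n.
apply: card_le_trans (selA (f i)).
(* Column [i] of the image of [A] is covered by the second coordinates of [pi] on the part of [A] in
   [P (f i)]. *)
apply: card_le_trans (card_image_le (fun n => (pi n).2) _).
apply: subset_card_le => m [n An pin].
by exists n; rewrite /P /= pin.
Qed.

Lemma not_selective_katetov_le_JL (I : set (set nat)) (hI : is_ideal I)
    (f : nat -> nat) :
  ~ locally_linear_selective I -> katetov_le (JL f) I.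
Proof.
move=> /existsNP[P /not_implyP[partP /not_implyP[IP nsel]]].
have selI A : linear_selector P A -> I A.
  by move=> selA; apply: contrapT => nIA; apply: nsel; exists A.
have [c cP] := partition_index partP.
have [g [gf goo]] := slow_reindexing f.
exists (fun n => (g (c n), n)) => A [k [N _ colA]].
(* For [j >= M], [N <= g j] makes the column bound apply, and [k <= g j] gives
   [k * f (g j) <= g j * f (g j) <= j]. *)
have [M _ gM] := goo (maxn k N).
set B := _ @^-1` A.
(* The pieces below [M] escape this bound, but their finite union is in [I]. *)
apply: (ideal_subset hI
  (B := (B `&` [set n | M <= c n]) `|` \bigcup_(i in `I_M) P i)).
  move=> n Bn; have [leMc|ltcM] := leqP M (c n); first by left.
  by right; exists (c n) => //; apply/cP.
apply: (ideal_setU hI); last exact: ideal_bigcup_II.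
apply: selI => j; have [leMj|ltjM] := leqP M j; last first.
  rewrite [X in X #<= _](_ : _ = set0) ?card_ge0//.
  by rewrite -subset0 => n [[_ /= leMc] /cP cj]; rewrite cj leqNgt ltjM in leMc.
have := gM j leMj; rewrite /= geq_max => /andP[lekg leNg].
apply: (@card_le_trans _ _ _ [set m | A (g j, m)]).
  by apply: subset_card_le => n [[Bn _] /cP cj]; rewrite /= -cj.
apply: card_le_trans (colA _ leNg) _.
apply: subset_card_le => m /= ltm; apply: leq_trans ltm _.
by apply: leq_trans (gf j); rewrite leq_mul2r lekg orbT.
Qed.

Theorem proposition6p5 (I : set (set nat)) (hI : is_ideal I) :
  [<-> forall f : nat -> nat, f @ \oo --> \oo -> katetov_le (JL f) I;
       exists2 f : nat -> nat, f @ \oo --> \oo & katetov_le (JL f) I;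
       ~ locally_linear_selective I].
Proof.
tfae.
- by move=> leI; exists id; [exact: cvg_id | apply: leI; exact: cvg_id].
- by move=> [f foo]; exact: katetov_le_JL_not_selective.
- by move=> nsel f _; exact: not_selective_katetov_le_JL.
Qed.
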